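(* Let $\mathbb{C}$ be a finitely complete pointed category which has coequalizers and in which regular epimorphisms are stable under binary products. If $\mathbb{C}$ is a majority category, then $\mathbb{C}$ satisfies (P).
   Context: Property (P) for a category $\mathbb{C}$ with binary products: for any two coequalizer diagrams $C_1 \rightrightarrows X \xrightarrow{q_1} X'$ (with parallel pair $u,v$) and $C_2 \rightrightarrows Y \xrightarrow{q_2} Y'$ (with parallel pair $u',v'$) in $\mathbb{C}$, the diagram $C_1\times C_2 \rightrightarrows X\times Y \xrightarrow{q_1\times q_2} X'\times Y'$ (with parallel pair $u\times u'$, $v\times v'$) is a coequalizer diagram in $\mathbb{C}$. Regular epimorphisms being stable under binary products means that $f\times g$ is a regular epimorphism whenever $f$ and $g$ are. A ternary relation $R$ between $X,Y,Z$ is a subobject of $X\times Y\times Z$, and for morphisms $x:S\to X$, $y:S\to Y$, $z:S\to Z$, $(x,y,z)\in R$ means that $(x,y,z):S\to X\times Y\times Z$ factors through $R$. The category $\mathbb{C}$ is a majority category if for any ternary relation $R$ between any objects $X,Y,Z$ and any generalized elements $x,x':S\to X$, $y,y':S\to Y$, $z,z':S\to Z$: if $(x,y,z')\in R$, $(x,y',z)\in R$ and $(x',y,z)\in R$, then $(x,y,z)\in R$. *)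

(* Defs.v *)
From Stdlib Require Import List FinFun.

Set Implicit Arguments.
Unset Strict Implicit.
Unset Printing Implicit Defensive.

Declare Scope cat_scope.
Delimit Scope cat_scope with cat.
Local Open Scope cat_scope.

Record category := Category {
  obj :> Type;
  hom : obj -> obj -> Type;
  idm : forall A : obj, hom A A;
  comp : forall A B C : obj, hom B C -> hom A B -> hom A C;
  comp_idl : forall (A B : obj) (f : hom A B), comp (idm B) f = f;
  comp_idr : forall (A B : obj) (f : hom A B), comp f (idm A) = f;
  comp_assoc : forall (A B C D : obj)
    (h : hom C D) (g : hom B C) (f : hom A B),
    comp h (comp g f) = comp (comp h g) f
}.

Arguments hom {c} A B.
Arguments idm {c} A.
Arguments comp {c A B C} g f.

Notation "A ~> B" := (hom A B) (at level 90, right associativity) : cat_scope.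
Notation "g ∘ f" := (comp g f) (at level 40, left associativity) : cat_scope.

Record functor (J C : category) := Functor {
  fobj :> J -> C;
  fmap : forall i j : J, (i ~> j) -> (fobj i ~> fobj j);
  fmap_id : forall i : J, fmap (idm i) = idm (fobj i);
  fmap_comp : forall (i j k : J) (b : j ~> k) (a : i ~> j),
    fmap (b ∘ a) = fmap b ∘ fmap a
}.

Arguments fmap {J C} f {i j} a.

Definition finite_category (J : category) : Prop :=
  Finite J /\ forall i j : J, Finite (i ~> j).

Section Notions.

Variable C : category.

Definition is_cone (J : category) (F : functor J C) (L : C)
    (p : forall i : J, L ~> F i) : Prop :=
  forall (i j : J) (a : i ~> j), fmap F a ∘ p i = p j.

Definition is_limit (J : category) (F : functor J C) (L : C)
    (p : forall i : J, L ~> F i) : Prop :=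
  is_cone p /\
  forall (S : C) (s : forall i : J, S ~> F i), is_cone s ->
    exists! k : S ~> L, forall i : J, p i ∘ k = s i.

Definition finitely_complete : Prop :=
  forall (J : category) (F : functor J C), finite_category J ->
    exists (L : C) (p : forall i : J, L ~> F i), is_limit p.

Definition is_initial (Z : C) : Prop :=
  forall A : C, exists! f : Z ~> A, True.

Definition is_terminal (Z : C) : Prop :=
  forall A : C, exists! f : A ~> Z, True.

Definition pointed : Prop :=
  exists Z : C, is_initial Z /\ is_terminal Z.

(* A product diagram on A and B, not a chosen one: statements about products
   quantify over all such diagrams, which are unique up to isomorphism. *)
Record product (A B : C) := Product {
  prod_obj :> C;
  fstm : prod_obj ~> A;
  sndm : prod_obj ~> B;
  pairm : forall S : C, (S ~> A) -> (S ~> B) -> (S ~> prod_obj);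
  fst_pair : forall (S : C) (a : S ~> A) (b : S ~> B), fstm ∘ pairm a b = a;
  snd_pair : forall (S : C) (a : S ~> A) (b : S ~> B), sndm ∘ pairm a b = b;
  pair_unique : forall (S : C) (a : S ~> A) (b : S ~> B) (k : S ~> prod_obj),
    fstm ∘ k = a -> sndm ∘ k = b -> k = pairm a b
}.

Definition prod_map (A B A' B' : C) (P : product A B) (P' : product A' B')
    (f : A ~> A') (g : B ~> B') : P ~> P' :=
  pairm P' (f ∘ fstm P) (g ∘ sndm P).

Definition is_coequalizer (A X Q : C) (u v : A ~> X) (q : X ~> Q) : Prop :=
  q ∘ u = q ∘ v /\
  forall (Z : C) (h : X ~> Z), h ∘ u = h ∘ v ->
    exists! k : Q ~> Z, k ∘ q = h.

Definition has_coequalizers : Prop :=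
  forall (A X : C) (u v : A ~> X),
    exists (Q : C) (q : X ~> Q), is_coequalizer u v q.

Definition regular_epi (X Q : C) (q : X ~> Q) : Prop :=
  exists (A : C) (u v : A ~> X), is_coequalizer u v q.

Definition regular_epis_stable_under_products : Prop :=
  forall (A B A' B' : C) (f : A ~> A') (g : B ~> B')
    (P : product A B) (P' : product A' B'),
    regular_epi f -> regular_epi g -> regular_epi (prod_map P P' f g).

Definition mono (A B : C) (m : A ~> B) : Prop :=
  forall (S : C) (a b : S ~> A), m ∘ a = m ∘ b -> a = b.

Definition factors_through (S A B : C) (f : S ~> B) (m : A ~> B) : Prop :=
  exists k : S ~> A, m ∘ k = f.

(* X * Y * Z is (X * Y) * Z, and a subobject is given by any monomorphism
   r representing it; (x, y, z) \in R does not depend on the choice of r. *)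
Definition in_rel3 (X Y Z : C) (XY : product X Y) (XYZ : product XY Z)
    (R : C) (r : R ~> XYZ) (S : C) (x : S ~> X) (y : S ~> Y) (z : S ~> Z) :
    Prop :=
  factors_through (pairm XYZ (pairm XY x y) z) r.

Definition majority_category : Prop :=
  forall (X Y Z : C) (XY : product X Y) (XYZ : product XY Z)
    (R : C) (r : R ~> XYZ), mono r ->
  forall (S : C) (x x' : S ~> X) (y y' : S ~> Y) (z z' : S ~> Z),
    in_rel3 r x y z' -> in_rel3 r x y' z -> in_rel3 r x' y z ->
    in_rel3 r x y z.

Definition property_P : Prop :=
  forall (C1 X X' : C) (u v : C1 ~> X) (q1 : X ~> X')
    (C2 Y Y' : C) (u' v' : C2 ~> Y) (q2 : Y ~> Y')
    (C12 : product C1 C2) (XY : product X Y) (XY' : product X' Y'),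
    is_coequalizer u v q1 -> is_coequalizer u' v' q2 ->
    is_coequalizer (prod_map C12 XY u u') (prod_map C12 XY v v')
      (prod_map XY XY' q1 q2).

End Notions.

(* Main.v *)
From Stdlib Require Import List FinFun ClassicalEpsilon.
Require Import Defs.

(** Let [h] coequalize [u × u'] and [v × v'].  Restricting along the zero map
    [0 : C1 -> C2] shows that [h (-, 0)] coequalizes [u, v], hence
    [h (x, 0) = h (x', 0)] as soon as [q1 x = q1 x'].  The relation
    [R = {(a, b, y) | h (a, y) = h (b, y)}] on [X, X, Y] then contains
    [(x, x', 0)], [(x, x, y)] and [(x', x', y)], so by majority it contains
    [(x, x', y)].  With the symmetric argument in the second variable, [h]
    identifies any two generalized elements identified by [q1 × q2], and
    therefore factors through this regular epimorphism. *)

Set Implicit Arguments.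
Unset Strict Implicit.
Unset Printing Implicit Defensive.

Local Open Scope cat_scope.

(** * Finite shapes for binary products and equalizers *)

Definition discrete_bool : category.
Proof.
refine (@Category bool (fun i j => i = j) (fun i => eq_refl)
  (fun i j k b a => eq_trans a b) _ _ _).
- intros i j a; destruct a; reflexivity.
- intros i j a; destruct a; reflexivity.
- intros i j k l c b a; destruct c, b, a; reflexivity.
Defined.

Lemma discrete_bool_finite : finite_category discrete_bool.
Proof.
split.
- exists (true :: false :: nil); intros [|]; simpl; auto.
- intros i j; destruct (Bool.bool_dec i j) as [e | ne].
  + exists (e :: nil); intros e'; left; apply Eqdep_dec.UIP_dec, Bool.bool_dec.
  + exists nil; intros e; contradiction.
Qed.

Definition pair_functor (C : category) (A B : C) : functor discrete_bool C.
Proof.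
pose (F := fun i : bool => if i then A else B).
refine (@Functor discrete_bool C F
  (fun i j (e : i = j) =>
     match e in _ = j return F i ~> F j with eq_refl => idm (F i) end) _ _).
- reflexivity.
- intros i j k b a; destruct b, a; symmetry; apply comp_idl.
Defined.

(** The vertex [true] is the source and [false] the target; the two parallel arrows are the elements
    of [bool]. *)
Definition parallel_hom (i j : bool) : Set :=
  match i, j with
  | true, false => bool
  | false, true => Empty_set
  | _, _ => unit
  end.

Definition parallel_pair : category.
Proof.
refine (@Category bool parallel_hom
  (fun i => match i return parallel_hom i i with true => tt | false => tt end)
  (fun i j k => match i, j, k
     return parallel_hom j k -> parallel_hom i j -> parallel_hom i k with
     | true, true, true => fun _ _ => tt
     | true, true, false => fun b _ => b
     | true, false, true => fun b _ => match b with end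
     | true, false, false => fun _ a => a
     | false, true, _ => fun _ a => match a with end
     | false, false, true => fun b _ => b
     | false, false, false => fun _ _ => tt
     end) _ _ _).
- intros [|] [|] []; reflexivity.
- intros [|] [|] []; reflexivity.
- intros [|] [|] [|] [|] [] [] []; reflexivity.
Defined.

Lemma parallel_pair_finite : finite_category parallel_pair.
Proof.
split.
- exists (true :: false :: nil); intros [|]; simpl; auto.
- intros [|] [|]; simpl.
  + exists (tt :: nil); intros []; simpl; auto.
  + exists (true :: false :: nil); intros [|]; simpl; auto.
  + exists nil; intros [].
  + exists (tt :: nil); intros []; simpl; auto.
Qed.

Definition parallel_functor (C : category) (A B : C) (f g : A ~> B) :
  functor parallel_pair C.
Proof.
pose (F := fun i : bool => if i then A else B).
refine (@Functor parallel_pair C F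
  (fun i j => match i, j return parallel_hom i j -> (F i ~> F j) with
     | true, true => fun _ => idm A
     | true, false => fun b => if b then f else g
     | false, true => fun e => match e with end
     | false, false => fun _ => idm B
     end) _ _).
- intros [|]; reflexivity.
- intros [|] [|] [|] [] []; simpl; symmetry;
    solve [apply comp_idl | apply comp_idr].
Defined.

(** * Products and equalizers from finite limits *)

Section FiniteLimits.

Variable C : category.
Hypothesis C_finitely_complete : finitely_complete C.

(** A limit only asserts that mediating morphisms exist uniquely, while [product] stores pairing as
    a function; a choice principle extracts it. *)
Lemma product_exists (A B : C) : inhabited (product A B).
Proof.
destruct (C_finitely_complete (pair_functor A B) discrete_bool_finite)
  as [L [p [_ p_univ]]].
assert (ex : forall (S : C) (a : S ~> A) (b : S ~> B),
  exists! k : S ~> L, p true ∘ k = a /\ p false ∘ k = b).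
{ intros S a b.
  destruct (p_univ S (fun i => match i return S ~> pair_functor A B i with
                               | true => a | false => b end))
    as [k [k_eq k_uniq]].
  { intros i j e; destruct e; apply comp_idl. }
  exists k; split.
  - exact (conj (k_eq true) (k_eq false)).
  - intros k' [k'1 k'2]; apply k_uniq; intros [|]; assumption. }
pose (pr := fun (S : C) (a : S ~> A) (b : S ~> B) =>
  constructive_indefinite_description _ (ex S a b)).
constructor.
refine (@Product C A B L (p true) (p false)
  (fun S a b => proj1_sig (pr S a b)) _ _ _).
- intros S a b; exact (proj1 (proj1 (proj2_sig (pr S a b)))).
- intros S a b; exact (proj2 (proj1 (proj2_sig (pr S a b)))).
- intros S a b k ka kb; symmetry.
  exact (proj2 (proj2_sig (pr S a b)) k (conj ka kb)).
Qed.

Lemma equalizer_exists (A B : C) (f g : A ~> B) :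
  exists (E : C) (e : E ~> A), mono e /\
    forall (S : C) (s : S ~> A), factors_through s e <-> f ∘ s = g ∘ s.
Proof.
destruct (C_finitely_complete (parallel_functor f g) parallel_pair_finite)
  as [E [p [p_cone p_univ]]].
pose (e := p true : E ~> A).
(* The last argument selects the arrow: [true] is sent to [f] and [false] to [g]. The leg at [false]
   is thus determined by [e]. *)
assert (pf : f ∘ e = p false) by exact (p_cone true false true).
assert (pg : g ∘ e = p false) by exact (p_cone true false false).
assert (fork : f ∘ e = g ∘ e) by congruence.
assert (univ : forall (S : C) (s : S ~> A), f ∘ s = g ∘ s ->
  exists! k : S ~> E, e ∘ k = s).
{ intros S s s_eq.
  destruct (p_univ S (fun i => match i return S ~> parallel_functor f g i with
                               | true => s | false => f ∘ s end))
    as [k [k_eq k_uniq]].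
  { intros [|] [|] []; simpl; auto using comp_idl. }
  exists k; split.
  - exact (k_eq true).
  - intros k' k'_eq; apply k_uniq; intros [|].
    + exact k'_eq.
    + rewrite <- pf, <- comp_assoc. apply f_equal; exact k'_eq. }
exists E, e; split.
- intros S a b ab.
  destruct (univ S (e ∘ a)) as [k [_ k_uniq]].
  { rewrite !comp_assoc; now rewrite fork. }
  rewrite <- (k_uniq a eq_refl); apply k_uniq; symmetry; exact ab.
- intros S s; split.
  + intros [k <-]; rewrite !comp_assoc; now rewrite fork.
  + intros s_eq; destruct (univ S s s_eq) as [k [k_eq _]]; now exists k.
Qed.

End FiniteLimits.

(** * Calculus of pairings, and zero morphisms *)

Section Products.

Variable C : category.

Lemma pair_comp (A B S T : C) (P : product A B)
    (a : S ~> A) (b : S ~> B) (t : T ~> S) :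
  pairm P a b ∘ t = pairm P (a ∘ t) (b ∘ t).
Proof.
apply pair_unique; rewrite comp_assoc; [rewrite fst_pair | rewrite snd_pair];
  reflexivity.
Qed.

Lemma pair_eta (A B S : C) (P : product A B) (k : S ~> P) :
  k = pairm P (fstm P ∘ k) (sndm P ∘ k).
Proof. now apply pair_unique. Qed.

Lemma prod_map_pair (A B A' B' S : C) (P : product A B) (P' : product A' B')
    (f : A ~> A') (g : B ~> B') (a : S ~> A) (b : S ~> B) :
  prod_map P P' f g ∘ pairm P a b = pairm P' (f ∘ a) (g ∘ b).
Proof.
unfold prod_map; rewrite pair_comp, <- !comp_assoc.
now rewrite fst_pair, snd_pair.
Qed.

Lemma prod_map_comp (A B A' B' A'' B'' : C) (P : product A B)
    (P' : product A' B') (P'' : product A'' B'')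
    (f' : A' ~> A'') (g' : B' ~> B'') (f : A ~> A') (g : B ~> B') :
  prod_map P' P'' f' g' ∘ prod_map P P' f g = prod_map P P'' (f' ∘ f) (g' ∘ g).
Proof. unfold prod_map at 2; now rewrite prod_map_pair, !comp_assoc. Qed.

(** The underlying object is kept, so a morphism out of [P] is, by conversion, also one out of the
    swapped product, and symmetric arguments need no transport. *)
Definition swap_product (A B : C) (P : product A B) : product B A :=
  @Product C B A P (sndm P) (fstm P) (fun S b a => pairm P a b)
    (fun S b a => snd_pair P a b) (fun S b a => fst_pair P a b)
    (fun S b a k kb ka => pair_unique ka kb).

(** The zero morphism from [A] to [B] passes through the zero object; both absorption laws follow
    from uniqueness of morphisms out of and into that object. *)
Lemma zero_family : pointed C ->
  exists z : forall A B : C, A ~> B,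
    (forall (A B D : C) (f : B ~> D), f ∘ z A B = z A D) /\
    (forall (A B D : C) (f : A ~> B), z B D ∘ f = z A D).
Proof.
intros [O [O_init O_term]].
pose (i := fun A => constructive_indefinite_description _ (O_init A)).
pose (t := fun A => constructive_indefinite_description _ (O_term A)).
exists (fun A B => proj1_sig (i B) ∘ proj1_sig (t A)); split.
- intros A B D f; rewrite comp_assoc; f_equal.
  symmetry; exact (proj2 (proj2_sig (i D)) _ I).
- intros A B D f; rewrite <- comp_assoc; f_equal.
  symmetry; exact (proj2 (proj2_sig (t A)) _ I).
Qed.

End Products.

(** * The majority argument and its consequence for coequalizers *)

Lemma majority_fst_congruence (C : category)
  (C_finitely_complete : finitely_complete C)
  (C_majority : majority_category C)
  (X Y Z S : C) (P : product X Y) (h : P ~> Z)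
  (x x' : S ~> X) (y0 y : S ~> Y) :
  h ∘ pairm P x y0 = h ∘ pairm P x' y0 ->
  h ∘ pairm P x y = h ∘ pairm P x' y.
Proof.
intros h_y0.
destruct (product_exists C_finitely_complete X X) as [XX].
destruct (product_exists C_finitely_complete XX Y) as [XXY].
destruct (equalizer_exists C_finitely_complete
  (h ∘ pairm P (fstm XX ∘ fstm XXY) (sndm XXY))
  (h ∘ pairm P (sndm XX ∘ fstm XXY) (sndm XXY))) as [R [r [r_mono r_in]]].
assert (in_R : forall a b c, in_rel3 (S := S) (XY := XX) r a b c <->
  h ∘ pairm P a c = h ∘ pairm P b c).
{ intros a b c; unfold in_rel3; rewrite r_in.
  rewrite <- !comp_assoc, !pair_comp, <- !comp_assoc.
  now rewrite snd_pair, fst_pair, fst_pair, snd_pair. }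
(* The three premises are [(x, x', y0)], which is the hypothesis, and [(x, x, y)] and [(x', x', y)],
   which hold by reflexivity. *)
apply in_R, (C_majority _ _ _ _ _ _ _ r_mono S x x' x' x y y0);
  now apply in_R.
Qed.

Lemma coequalizer_fst_congruence (C : category)
  (C_finitely_complete : finitely_complete C)
  (C_pointed : pointed C)
  (C_majority : majority_category C)
  (C1 X X' C2 Y Z S : C) (u v : C1 ~> X) (q : X ~> X') (u' v' : C2 ~> Y)
  (C12 : product C1 C2) (XY : product X Y) (h : XY ~> Z)
  (x x' : S ~> X) (y : S ~> Y) :
  is_coequalizer u v q ->
  h ∘ prod_map C12 XY u u' = h ∘ prod_map C12 XY v v' ->
  q ∘ x = q ∘ x' ->
  h ∘ pairm XY x y = h ∘ pairm XY x' y.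
Proof.
intros [_ q_univ] h_eq qx.
destruct (zero_family C_pointed) as [z [z_l z_r]].
destruct (q_univ Z (h ∘ pairm XY (idm X) (z X Y))) as [k [k_eq _]].
(* Precomposition with [(1, 0)] turns [u'] and [v'] into the same zero morphism, leaving [u] and [v]
   in the first component. *)
{ pose proof (f_equal (fun m => m ∘ pairm C12 (idm C1) (z C1 C2)) h_eq) as E.
  cbn beta in E.
  rewrite <- !comp_assoc, !prod_map_pair, !comp_idr, !z_l in E.
  now rewrite <- !comp_assoc, !pair_comp, !comp_idl, !z_r. }
apply (majority_fst_congruence C_finitely_complete C_majority (y0 := z S Y)).
assert (h_zero : forall a : S ~> X, h ∘ pairm XY a (z S Y) = k ∘ (q ∘ a)).
{ intros a; rewrite comp_assoc, k_eq, <- comp_assoc, pair_comp.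
  now rewrite comp_idl, z_r. }
now rewrite !h_zero, qx.
Qed.

Theorem proposition4 (C : category)
  (C_finitely_complete : finitely_complete C)
  (C_pointed : pointed C)
  (C_coequalizers : has_coequalizers C)
  (C_regular_epis : regular_epis_stable_under_products C)
  (C_majority : majority_category C) :
  property_P C.
Proof.
intros C1 X X' u v q1 C2 Y Y' u' v' q2 C12 XY XY' q1_coeq q2_coeq.
split.
{ rewrite !prod_map_comp; now rewrite (proj1 q1_coeq), (proj1 q2_coeq). }
intros Z h h_eq.
(* The pair [a, b] coequalized by [q1 × q2] is unknown, so [h] has to identify whatever [q1 × q2]
   identifies. *)
destruct (C_regular_epis _ _ _ _ q1 q2 XY XY') as [A [a [b [ab q_univ]]]].
{ now exists C1, u, v. }
{ now exists C2, u', v'. }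
apply q_univ.
rewrite (pair_eta a), (pair_eta b) in ab |- *.
rewrite !prod_map_pair in ab.
pose proof (f_equal (fun m => fstm XY' ∘ m) ab) as ab1.
pose proof (f_equal (fun m => sndm XY' ∘ m) ab) as ab2.
cbn beta in ab1, ab2; rewrite !fst_pair in ab1; rewrite !snd_pair in ab2.
(* One coordinate is changed at a time, from [a] to [b]. *)
transitivity (h ∘ pairm XY (fstm XY ∘ b) (sndm XY ∘ a)).
- exact (coequalizer_fst_congruence C_finitely_complete C_pointed C_majority
    _ q1_coeq h_eq ab1).
(* For the swapped products, [h_eq] already has the required form up to conversion. *)
- exact (coequalizer_fst_congruence C_finitely_complete C_pointed C_majority
    (C12 := swap_product C12) (XY := swap_product XY) _ q2_coeq h_eq ab2).
Qed.
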